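(* Let $\phi_4:\mathbb{Z}_4\to\mathbb{R}_+$ be the weight function $\phi_4(0)=0$, $\phi_4(1)=\phi_4(3)=1$, $\phi_4(2)=\frac85$. Then for all $f\in L_2^+(\mathbb{Z}_4,\mu_4)$, $$\int_{\mathbb{Z}_4} f^2\log f^2\,d\mu_4-\|f\|_2^2\log\|f\|_2^2\le 2\langle f,A_{\phi_4}f\rangle_{L_2(\mathbb{Z}_4,\mu_4)}.$$
   Context: $\mathbb{Z}_4=\{0,1,2,3\}$ is the cyclic group of order $4$ with normalized counting measure $\mu_4$ (each point has mass $1/4$). $L_2^+(\mathbb{Z}_4,\mu_4)$ is the set of nonnegative real-valued functions on $\mathbb{Z}_4$; $\|f\|_2^2=\frac14\sum_x|f(x)|^2$ and $\langle\cdot,\cdot\rangle_{L_2(\mathbb{Z}_4,\mu_4)}$ is the corresponding inner product. The convention $0\log0=0$ is used. With $\chi_k(x)=e^{2\pi i kx/4}$, the operator $A_{\phi_4}$ is $A_{\phi_4}\big(\sum_{k=0}^{3}a_k\chi_k\big)=\sum_{k=0}^{3}\phi_4(k)a_k\chi_k$. *)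

(* Defs.v *)
From HB Require Import structures.
From mathcomp Require Import all_boot all_order all_algebra.
From mathcomp Require Import all_classical all_reals all_analysis.
From mathcomp Require Import complex ring.

Set Implicit Arguments.
Unset Strict Implicit.
Unset Printing Implicit Defensive.

Import Order.TTheory GRing.Theory Num.Theory.

Local Open Scope ring_scope.
Local Open Scope complex_scope.

(* Integral over Z_4 against mu_4, for real- and complex-valued functions. *)
Definition mean4 (K : numFieldType) (g : 'Z_4 -> K) : K :=
  4^-1 * \sum_(x : 'Z_4) g x.

Definition norm2sq (K : numFieldType) (g : 'Z_4 -> K) : K :=
  mean4 (fun x => `|g x| ^+ 2).

(* Linear in the first argument. *)
Definition inner4 (R : realType) (g h : 'Z_4 -> R[i]) : R[i] :=
  mean4 (fun x => g x * ((h x)^*)%R).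

(* exp (2 pi i k x / 4), where k and x are represented in {0, 1, 2, 3} *)
Definition chi (R : realType) (k x : 'Z_4) : R[i] :=
  let t : R := 2 * pi * (k * x)%N%:R / 4 in cos t +i* sin t.

Definition fourier4 (R : realType) (g : 'Z_4 -> R[i]) (k : 'Z_4) : R[i] :=
  inner4 g (chi R k).

(* fourier4 g k is the coefficient of chi k in g (fourier4_expansion), so this
   is the diagonal operator sum_k a_k chi_k |-> sum_k phi(k) a_k chi_k
   (multiplier4_sum). *)
Definition multiplier4 (R : realType) (phi : 'Z_4 -> R) (g : 'Z_4 -> R[i])
    (x : 'Z_4) : R[i] :=
  \sum_(k : 'Z_4) (phi k)%:C * fourier4 g k * chi R k x.

Definition phi4 (R : realType) (k : 'Z_4) : R :=
  match val k with
  | 0 => 0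
  | 2 => 8 / 5
  | _ => 1
  end.

(* ln 0 is a real number in the library, so the integrand is 0 where f is 0. *)
Definition entropy_sq4 (R : realType) (f : 'Z_4 -> R) : R :=
  mean4 (fun x => f x ^+ 2 * ln (f x ^+ 2)) - norm2sq f * ln (norm2sq f).

Lemma chiE (R : realType) (k x : 'Z_4) : chi R k x = 'i%C ^+ (k * x)%N.
Proof.
rewrite /chi; elim: ((k : nat) * x)%N => [|n IH].
  by rewrite expr0 mulr0 mul0r cos0 sin0.
have -> : 2 * pi * n.+1%:R / 4 = 2 * pi * n%:R / 4 + pi / 2 :> R.
  by rewrite -natr1; field.
rewrite cosDpihalf sinDpihalf exprS -IH.
by simpc.
Qed.

Lemma chi_orthonormal (R : realType) (j k : 'Z_4) :
  inner4 (chi R j) (chi R k) = (j == k)%:R.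
Proof.
have i2 : 'i%C * 'i%C = -1 :> R[i] by rewrite -expr2 sqr_i.
have iJ : (('i%C : R[i])^*)%R = - 'i%C by apply/eqP; rewrite eq_complex /= oppr0 !eqxx.
have J1 : ((1 : R[i])^*)%R = 1 by rewrite rmorph1.
rewrite /inner4 /mean4 !big_ord_recl big_ord0 !chiE.
case: j => [[|[|[|[|//]]]] hj]; case: k => [[|[|[|[|//]]]] hk].
all: rewrite /= /bump /= ?muln0 ?mul0n ?expr0 ?(mulnE,addnE) /=.
all: rewrite ?rmorphXn /= ?iJ ?J1.
all: rewrite ?(exprS, expr0, i2, mulr1, mul1r, mulrN, mulNr, mulrN1, mulN1r, opprK).
all: by field.
Qed.

Lemma chi_complete (R : realType) (x y : 'Z_4) :
  \sum_(k : 'Z_4) ((chi R k y)^*)%R * chi R k x = (4 * (x == y)%:R).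
Proof.
have := chi_orthonormal R x y; rewrite /inner4 /mean4 => <-.
rewrite mulrA mulfV ?mul1r ?pnatr_eq0 //; apply: eq_bigr => k _.
by rewrite mulrC !chiE ![(k * _)%N]mulnC.
Qed.

Lemma fourier4_expansion (R : realType) (g : 'Z_4 -> R[i]) (x : 'Z_4) :
  \sum_(k : 'Z_4) fourier4 g k * chi R k x = g x.
Proof.
rewrite /fourier4 /inner4 /mean4.
under eq_bigr => k _ do rewrite -mulrA mulr_suml mulr_sumr.
rewrite exchange_big /=.
under eq_bigr => y _.
  under eq_bigr => k _ do rewrite -mulrA mulrCA.
  rewrite -mulr_sumr -mulr_sumr chi_complete (mulrA 4^-1) mulVf ?pnatr_eq0 // mul1r.
  over.
rewrite (bigD1 x) //= eqxx mulr1 big1 ?addr0 // => y yx.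
by rewrite eq_sym (negbTE yx) mulr0.
Qed.

Lemma multiplier4_sum (R : realType) (phi : 'Z_4 -> R) (a : 'Z_4 -> R[i])
    (x : 'Z_4) :
  multiplier4 phi (fun y => \sum_(k : 'Z_4) a k * chi R k y) x =
  \sum_(k : 'Z_4) (phi k)%:C * a k * chi R k x.
Proof.
apply: eq_bigr => k _; congr (_ * _ * _).
rewrite /fourier4 /inner4 /mean4.
under eq_bigr => y _ do rewrite mulr_suml.
rewrite exchange_big /= mulr_sumr.
under eq_bigr => j _.
  under eq_bigr => y _ do rewrite -mulrA.
  rewrite -mulr_sumr mulrCA.
  have := chi_orthonormal R j k; rewrite /inner4 /mean4 => ->.
  over.
rewrite (bigD1 k) //= eqxx mulr1 big1 ?addr0 // => j jk.
by rewrite (negbTE jk) mulr0.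
Qed.

(* Main.v *)
Require Import Defs.
From HB Require Import structures.
From mathcomp Require Import all_boot all_order all_algebra.
From mathcomp Require Import all_classical all_reals all_analysis.
From mathcomp Require Import complex.
From mathcomp Require Import ring lra.

Import Order.TTheory GRing.Theory Num.Theory.
Import numFieldNormedType.Exports.

Local Open Scope ring_scope.
Local Open Scope complex_scope.

(** Write a, b, c, d for the values of f at 0, 1, 2, 3. By Parseval
    ([inner4_multiplier]) the right-hand side is
      ((a-c)^2 + (b-d)^2) / 4 + (a+c-b-d)^2 / 5   ([energy_Z4]),
    and both sides are homogeneous of degree 2 ([entropy_sq4_scale]), so one may
    assume that the mean of f^2 is 1. The term with the logarithm of the norm
    then vanishes and the inequality becomes
      sum_x f(x)^2 ln f(x)^2 <= (a-c)^2 + (b-d)^2 + 4/5 (a+c-b-d)^2.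

    The constant 8/5 is critical at f = 1: along
    f = 1 + (w+s, -w, w-s, -w) with w of order s^2 the two sides agree up to
    order s^4 for a suitable ratio of w to s^2, and they only differ at order
    s^6. So the logarithm has to be replaced by something that is exact at 1 to
    order 5. Its Taylor polynomial of degree 5 at 1 is a global upper bound of
    x^2 ln x^2 on x >= 0 ([sqr_ln_sqr_le_jet]), since the sixth derivative is
    negative, and it loses little elsewhere. What remains is a polynomial
    inequality on a sphere ([jet_inequality]).

    To prove it, put
      a, c = 1 - n + w +- s     and     b, d = 1 - n - w +- t.
    The polynomial is even in s and in t, and the normalization reads
      s^2 + t^2 = N   where   N = 4n - 2n^2 - 2w^2,
    so that only n, w and D = s^2 - t^2 are left, with |D| <= N. Half the
    difference of the two sides is a convex quadratic in D,
      (1+2n)/12 (N^2 + D^2) - w L D + B,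
    and by the symmetry that exchanges the two pairs one may take w >= 0
    ([quadratic_in_gap_ge0]). If its vertex lies in |D| <= N the term B >= 0
    suffices; otherwise the minimum is at D = N, that is b = d, where the
    inequality is tight to leading order: there the quadratic part in (n, w) is
    the square 12/5 (w - 5n/3)^2 and positivity comes from the cubic terms
    ([quadratic_at_extreme_gap_ge0]). *)

(** * Energy and entropy on the cyclic group of order four *)

Lemma sum_Z4 (V : nmodType) (F : 'Z_4 -> V) :
  \sum_(x : 'Z_4) F x = F 0 + F 1 + F 2 + F 3.
Proof.
rewrite !big_ord_recl big_ord0 addr0 !addrA.
by congr (F _ + F _ + F _ + F _); apply/val_inj.
Qed.

(** Parseval for the multiplier: expanding [multiplier4 phi g] in characters,
    the pairing of [g] with each character is again a Fourier coefficient. *)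
Lemma inner4_multiplier (R : realType) (phi : 'Z_4 -> R) (g : 'Z_4 -> R[i]) :
  inner4 g (multiplier4 phi g) =
  \sum_(k : 'Z_4) (phi k)%:C * (fourier4 g k * ((fourier4 g k)^*)%R).
Proof.
rewrite {1}/inner4 /mean4 /multiplier4.
under eq_bigr => x _ do rewrite rmorph_sum mulr_sumr.
rewrite exchange_big mulr_sumr; apply: eq_bigr => k _.
rewrite {2}/fourier4 /inner4 /mean4 !mulr_sumr mulr_suml mulr_sumr.
apply: eq_bigr => x _.
rewrite !rmorphM /=.
have -> : (((phi k)%:C)^*)%R = (phi k)%:C.
  by apply/eqP; rewrite eq_complex /= oppr0 !eqxx.
ring.
Qed.

Lemma energy_Z4 (R : realType) (f : 'Z_4 -> R) :
  inner4 (fun x => (f x)%:C) (multiplier4 (@phi4 R) (fun x => (f x)%:C)) =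
  (((f 0 - f 2) ^+ 2 + (f 1 - f 3) ^+ 2) / 8 +
   (f 0 + f 2 - f 1 - f 3) ^+ 2 / 10)%:C.
Proof.
have iJ : (('i%C : R[i])^*)%R = - 'i%C.
  by apply/eqP; rewrite eq_complex /= oppr0 !eqxx.
have q4 : (4^-1 : R[i]) = (4^-1 : R)%:C by rewrite fmorphV /= rmorph_nat.
have f1 : fourier4 (fun x => (f x)%:C) 1 =
    (f 0 - f 2) / 4 +i* ((f 3 - f 1) / 4).
  rewrite /fourier4 /inner4 /mean4 sum_Z4 !chiE !rmorphXn /= iJ.
  rewrite !mul1n /= q4 !exprS expr0.
  apply/eqP; rewrite eq_complex /=; apply/andP; split; apply/eqP; by field.
have f2 : fourier4 (fun x => (f x)%:C) 2 =
    ((f 0 + f 2 - f 1 - f 3) / 4)%:C.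
  rewrite /fourier4 /inner4 /mean4 sum_Z4 !chiE !rmorphXn /= iJ.
  rewrite ?(muln0, mulnE) /= q4 !exprS expr0.
  apply/eqP; rewrite eq_complex /=; apply/andP; split; apply/eqP; by field.
have f3 : fourier4 (fun x => (f x)%:C) 3 =
    (f 0 - f 2) / 4 +i* ((f 1 - f 3) / 4).
  rewrite /fourier4 /inner4 /mean4 sum_Z4 !chiE !rmorphXn /= iJ.
  rewrite ?(muln0, mulnE) /= q4 !exprS expr0.
  apply/eqP; rewrite eq_complex /=; apply/andP; split; apply/eqP; by field.
rewrite (inner4_multiplier R (@phi4 R) (fun x => (f x)%:C)) sum_Z4.
rewrite f1 f2 f3 /phi4 /= mul0r add0r.
apply/eqP; rewrite eq_complex /=; apply/andP; split; apply/eqP; by field.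
Qed.

Lemma norm2sq_ge0 {R : realType} (g : 'Z_4 -> R) : 0 <= norm2sq g.
Proof.
by rewrite /norm2sq /mean4 mulr_ge0 ?sumr_ge0 // => x _; rewrite exprn_ge0.
Qed.

Lemma norm2sq_scale {R : realType} (r : R) (g : 'Z_4 -> R) :
  norm2sq (fun x => r * g x) = r ^+ 2 * norm2sq g.
Proof.
rewrite /norm2sq /mean4 [RHS]mulrCA; congr (_ * _); rewrite mulr_sumr.
by apply: eq_bigr => x _; rewrite !real_normK ?num_real // exprMn.
Qed.

(** The terms with [ln (r ^+ 2)] coming from the integrand and from the norm
    cancel. *)
Lemma entropy_sq4_scale {R : realType} (r : R) (g : 'Z_4 -> R) : 0 < r ->
  entropy_sq4 (fun x => r * g x) = r ^+ 2 * entropy_sq4 g.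
Proof.
move=> r0; have r2 : 0 < r ^+ 2 by rewrite exprn_gt0.
have xlnM (y : R) : 0 <= y -> r ^+ 2 * y * ln (r ^+ 2 * y) =
    r ^+ 2 * (y * ln (r ^+ 2) + y * ln y).
  rewrite le_eqVlt => /orP[/eqP <-|y0]; first by rewrite !(mulr0, mul0r, addr0).
  by rewrite lnM ?posrE // -mulrA mulrDr.
rewrite /entropy_sq4 norm2sq_scale xlnM ?norm2sq_ge0 // /mean4.
under eq_bigr => x _ do rewrite exprMn (xlnM _ (sqr_ge0 _)).
rewrite -mulr_sumr big_split /= -mulr_suml.
have -> : \sum_x g x ^+ 2 = 4 * norm2sq g.
  rewrite /norm2sq /mean4 mulrA mulfV ?mul1r ?pnatr_eq0 //.
  by apply: eq_bigr => x _; rewrite real_normK ?num_real.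
by field.
Qed.

(** * A polynomial majorant of x^2 ln x^2 *)

(** The Taylor polynomial of degree 5 of x^2 ln x^2 at 1, in [g] = x - 1. *)
Definition sqr_ln_sqr_jet {R : realFieldType} (g : R) : R :=
  2 * g + 3 * g ^+ 2 + 2 / 3 * g ^+ 3 - g ^+ 4 / 6 + g ^+ 5 / 15.

(** After division by 2 x^2 the Taylor error has a derivative with a single
    term, because it must vanish to order 5 at 1 and its numerator has degree 5;
    its sign is that of x - 1. *)
Lemma is_derive_ln_gap {R : realType} {x : R} : 0 < x ->
  is_derive x 1 (fun y : R => sqr_ln_sqr_jet (y - 1) / (2 * y ^+ 2) - ln y)
    ((x - 1) ^+ 5 / (10 * x ^+ 3)).
Proof.
move=> hx; rewrite /sqr_ln_sqr_jet.
have x2 : 2 * x ^+ 2 != 0 by apply: lt0r_neq0; nra.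
have xl := is_derive1_ln hx.
apply: is_derive_eq.
rewrite /GRing.scale /=.
by field; apply: lt0r_neq0.
Qed.

Lemma ln_le_jet {R : realType} (x : R) : 0 < x ->
  ln x <= sqr_ln_sqr_jet (x - 1) / (2 * x ^+ 2).
Proof.
move=> hx.
pose psi (y : R) := sqr_ln_sqr_jet (y - 1) / (2 * y ^+ 2) - ln y.
have psi1 : psi 1 = 0 by rewrite /psi /sqr_ln_sqr_jet subrr ln1; field.
have cont (a b : R) : 0 < a -> {within `[a, b], continuous psi}%classic.
  move=> a0; apply: derivable_within_continuous => y /itvP yab.
  have y0 : 0 < y by apply: lt_le_trans a0 _; rewrite yab.
  by have [] := is_derive_ln_gap y0.
rewrite -subr_ge0 -/(psi x).
have [x1|x1] := lerP 1 x.
- have [] := @MVT_segment R psi (fun y => (y - 1) ^+ 5 / (10 * y ^+ 3)) 1 x x1.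
  + move=> y /itvP yx; apply: is_derive_ln_gap.
    by rewrite (lt_trans _ (_ : 1 < y)) ?yx.
  + exact: cont.
  move=> c /itvP cx; rewrite psi1 subr0 => ->.
  have c1 : 1 <= c by rewrite cx.
  rewrite mulr_ge0 ?subr_ge0 // divr_ge0 ?exprn_ge0 ?subr_ge0 // mulr_ge0 //.
  by rewrite exprn_ge0 // (le_trans ler01).
- have [] := @MVT_segment R psi (fun y => (y - 1) ^+ 5 / (10 * y ^+ 3)) x 1
    (ltW x1).
  + by move=> y /itvP yx; apply: is_derive_ln_gap; rewrite (lt_trans hx) ?yx.
  + exact: cont.
  move=> c /itvP cx; rewrite psi1 sub0r => /eqP; rewrite eqr_oppLR => /eqP ->.
  have c1 : c <= 1 by rewrite cx.
  have c0 : 0 < c by rewrite (lt_le_trans hx) ?cx.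
  rewrite -mulNr mulr_ge0 ?subr_ge0 ?(ltW x1) // -mulNr divr_ge0 //.
    rewrite -[X in X ^+ _]opprB exprNn -signr_odd /= expr1 mulN1r opprK.
    by rewrite exprn_ge0 ?subr_ge0.
  by rewrite mulr_ge0 // exprn_ge0 // ltW.
Qed.

Lemma sqr_ln_sqr_le_jet {R : realType} (x : R) : 0 <= x ->
  x ^+ 2 * ln (x ^+ 2) <= sqr_ln_sqr_jet (x - 1).
Proof.
rewrite le_eqVlt => /orP[/eqP <-|hx].
  by rewrite expr2 !mul0r /sqr_ln_sqr_jet; lra.
have x2 : 0 < 2 * x ^+ 2 by rewrite mulr_gt0 ?exprn_gt0.
have := ln_le_jet x hx; rewrite ler_pdivlMr // lnXn // -mulr_natl.
lra.
Qed.

(** * The polynomial inequality *)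

(** The value of s^2 + t^2 forced by the normalization, for the vector
    (1-n+w+s, 1-n-w+t, 1-n+w-s, 1-n-w-t). *)
Definition spread {R : realFieldType} (n w : R) : R :=
  4 * n - 2 * n ^+ 2 - 2 * w ^+ 2.

(** Up to the factor -w, the coefficient of D = s^2 - t^2 in half the
    difference of the two sides. *)
Definition gap_slope {R : realFieldType} (n : R) : R :=
  2 + 10 / 3 * n + 4 / 3 * n ^+ 2.

(** What half the difference of the two sides contains besides the terms
    (1+2n)/12 (N^2 + D^2) and -w L D, with N = [spread n w] and
    L = [gap_slope n]. *)
Definition gap_remainder {R : realFieldType} (n w : R) : R :=
  12 / 5 * w ^+ 2 + 4 * n ^+ 2 + 4 * n * w ^+ 2 + 4 / 3 * n ^+ 3
  - 5 / 3 * w ^+ 4 + 6 * n ^+ 2 * w ^+ 2 + n ^+ 4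
  - 10 / 3 * n * w ^+ 4 - 4 * n ^+ 3 * w ^+ 2 - 6 / 5 * n ^+ 5.

Lemma gap_remainder_ge0 {R : realFieldType} (n w : R) :
  0 <= n -> n <= 1 -> 0 <= spread n w -> 0 <= gap_remainder n w.
Proof.
rewrite /spread /gap_remainder => n0 n1 hN.
set W := w ^+ 2 in hN *.
have -> : w ^+ 4 = W ^+ 2 by rewrite /W -exprM.
have W0 : 0 <= W by rewrite sqr_ge0.
(* This multiple of the spread absorbs exactly the negative terms in W^2. *)
have h1 : 0 <= (5 / 6 + 5 / 3 * n) * (W * (4 * n - 2 * n ^+ 2 - 2 * W)).
  by rewrite mulr_ge0 //; [lra | rewrite mulr_ge0].
have h2 : 0 <= 1 - n ^+ 2 by nra.
have h3 : 0 <= n ^+ 2 by nra.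
have h4 : 0 <= n ^+ 3 by rewrite exprn_ge0.
have h5 : 0 <= n ^+ 3 * (1 - n ^+ 2) by rewrite mulr_ge0.
have h6 : 0 <= W * n by rewrite mulr_ge0.
have h8 : 0 <= W * n ^+ 2 by rewrite mulr_ge0.
have h9 : 0 <= n * (W * (1 - n ^+ 2)).
  by rewrite mulr_ge0 // mulr_ge0.
have h10 : 0 <= W * n ^+ 3 by rewrite mulr_ge0.
have h11 : 0 <= n ^+ 4 by rewrite exprn_ge0.
nra.
Qed.

(** The critical case D = N. At leading order the polynomial is
    12/5 (w - 5n/3)^2, so no crude estimate is possible. The quartic term in w
    is traded for a quadratic one through the bound on w^2 contained in
    [0 <= spread n w], and the cubic term for a quadratic one by the tangent
    inequality w (w - n)^2 >= 0; what is left is a quadratic form in (n, w)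
    whose coefficients, polynomials in n, satisfy the discriminant condition on
    [0, 1]. At n = 0 that discriminant vanishes, which expresses that 8/5 is
    optimal. *)
Lemma quadratic_at_extreme_gap_ge0 {R : realFieldType} (n w : R) :
  0 <= n -> n <= 1 -> 0 <= w -> 0 <= spread n w ->
  0 <= (1 + 2 * n) / 6 * spread n w ^+ 2 - w * gap_slope n * spread n w
       + gap_remainder n w.
Proof.
move=> n0 n1 w0 hN.
set X := (X in 0 <= X).
pose a : R := 12 / 5 + 22 / 3 * n + 37 / 3 * n ^+ 2 + 6 * n ^+ 3.
pose b : R := 8 + 40 / 3 * n + 16 / 3 * n ^+ 2.
pose c : R := 20 / 3 + 4 * n - 11 / 3 * n ^+ 2 + 2 / 15 * n ^+ 3.
have EX : X = (a * w ^+ 2 - b * (n * w) + c * n ^+ 2)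
   + (4 + 20 / 3 * n + 8 / 3 * n ^+ 2) * (w * (w - n) ^+ 2)
   + (1 + 2 * n) / 2 * (w ^+ 2 * spread n w).
  by rewrite /X /a /b /c /gap_remainder /gap_slope /spread; field.
have a0 : 0 < a.
  have : 0 <= n ^+ 3 by rewrite exprn_ge0.
  by rewrite /a; nra.
have disc : b ^+ 2 <= 4 * a * c.
  have h4 : n ^+ 4 <= n ^+ 2 by rewrite ler_wiXn2l.
  have h5 : n ^+ 5 <= n ^+ 3 by rewrite ler_wiXn2l.
  have h2 : 0 <= n ^+ 2 by rewrite exprn_ge0.
  have h3 : 0 <= n ^+ 3 by rewrite exprn_ge0.
  have h6 : 0 <= n ^+ 6 by rewrite exprn_ge0.
  by rewrite /a /b /c; lra.
rewrite EX; apply: addr_ge0; first apply: addr_ge0.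
- rewrite -(pmulr_rge0 _ (_ : 0 < 4 * a)); last by lra.
  have -> : 4 * a * (a * w ^+ 2 - b * (n * w) + c * n ^+ 2) =
      (2 * a * w - b * n) ^+ 2 + n ^+ 2 * (4 * a * c - b ^+ 2) by ring.
  apply: addr_ge0; first exact: sqr_ge0.
  by apply: mulr_ge0; [exact: sqr_ge0 | rewrite subr_ge0].
- apply: mulr_ge0; first by nra.
  by apply: mulr_ge0; [| exact: sqr_ge0].
- apply: mulr_ge0; first by lra.
  by apply: mulr_ge0; [exact: sqr_ge0 |].
Qed.

Lemma quadratic_in_gap_ge0 {R : realFieldType} (n w D : R) :
  0 <= n -> n <= 1 -> - spread n w <= D -> D <= spread n w ->
  0 <= (1 + 2 * n) / 12 * (spread n w ^+ 2 + D ^+ 2) - w * gap_slope n * D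
       + gap_remainder n w.
Proof.
move=> n0 n1.
(* Exchanging the pairs (a, c) and (b, d) changes the signs of w and D. *)
wlog w0 : w D / 0 <= w.
  move=> H hD1 hD2; have [w0|w0] := lerP 0 w; first exact: H.
  have EN : spread n (- w) = spread n w by rewrite /spread; ring.
  have EB : gap_remainder n (- w) = gap_remainder n w.
    by rewrite /gap_remainder; ring.
  have := H (- w) (- D); rewrite EN EB; rewrite sqrrN mulNr mulNr mulrN opprK.
  by apply; lra.
move=> hD1 hD2.
have N0 : 0 <= spread n w by lra.
have L0 : 0 <= gap_slope n by rewrite /gap_slope; nra.
have wL0 : 0 <= w * gap_slope n by rewrite mulr_ge0.
(* The vertex of the quadratic is at D = 6 w L / (1 + 2n); it is compared
   with N. *)
have [large|small] := lerP ((1 + 2 * n) / 6 * spread n w) (w * gap_slope n).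
- have P1 := quadratic_at_extreme_gap_ge0 n w n0 n1 w0 N0.
  (* This product is the value at D minus the value at N. *)
  have : 0 <= (spread n w - D) *
      (w * gap_slope n - (1 + 2 * n) / 12 * (spread n w + D)).
    rewrite mulr_ge0 ?subr_ge0 // (le_trans _ large) //.
    have : 0 <= (1 + 2 * n) * (spread n w - D) by rewrite mulr_ge0; lra.
    by lra.
  by lra.
- have B0 := gap_remainder_ge0 n w n0 n1 N0.
  have [D0|D0] := lerP 0 D.
  + have h1 : 0 <= D * ((1 + 2 * n) / 6 * spread n w - w * gap_slope n).
      by rewrite mulr_ge0 // subr_ge0 ltW.
    have h2 : 0 <= (1 + 2 * n) * (spread n w - D) ^+ 2.
      by rewrite mulr_ge0 ?sqr_ge0 //; lra.
    by lra.
  + have h1 : 0 <= w * gap_slope n * (- D) by rewrite mulr_ge0 //; lra.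
    have h2 : 0 <= (1 + 2 * n) * (spread n w ^+ 2 + D ^+ 2).
      by rewrite mulr_ge0 ?addr_ge0 ?sqr_ge0 //; lra.
    by lra.
Qed.

Lemma jet_inequality {R : realFieldType} (a b c d : R) :
  0 <= a -> 0 <= b -> 0 <= c -> 0 <= d ->
  a ^+ 2 + b ^+ 2 + c ^+ 2 + d ^+ 2 = 4 ->
  sqr_ln_sqr_jet (a - 1) + sqr_ln_sqr_jet (b - 1) +
  sqr_ln_sqr_jet (c - 1) + sqr_ln_sqr_jet (d - 1) <=
  (a - c) ^+ 2 + (b - d) ^+ 2 + 4 / 5 * (a + c - b - d) ^+ 2.
Proof.
move=> a0 b0 c0 d0 hM.
pose n := 1 - (a + b + c + d) / 4.
pose w := (a + c - b - d) / 4.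
pose s := (a - c) / 2; pose t := (b - d) / 2.
have EN : spread n w = s ^+ 2 + t ^+ 2.
  by rewrite /spread /n /w /s /t; lra.
have s0 := sqr_ge0 s; have t0 := sqr_ge0 t; have w0 := sqr_ge0 w.
have n1 : n <= 1 by rewrite /n; lra.
have n0 : 0 <= n by move: EN; rewrite /spread; nra.
have := quadratic_in_gap_ge0 n w (s ^+ 2 - t ^+ 2) n0 n1.
rewrite EN => /(_ ltac:(lra) ltac:(lra)).
have -> : d = 1 - n - w - t by rewrite /n /w /t; field.
have -> : b = 1 - n - w + t by rewrite /n /w /t; field.
have -> : c = 1 - n + w - s by rewrite /n /w /s; field.
have -> : a = 1 - n + w + s by rewrite /n /w /s; field.
clearbody n w s t; move: EN.
rewrite /spread /gap_slope /gap_remainder /sqr_ln_sqr_jet => EN.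
set X := (X in 0 <= X -> _) => X0.
rewrite -subr_ge0; set Y := (Y in 0 <= Y).
(* The second summand vanishes by the normalization. Its cofactor records where
   s^2 + t^2 was replaced by N: in the terms of the jet of degree at most 2, in
   the part of the coefficients of s^2 and t^2 that is symmetric in the pairs,
   and in the antisymmetric part of the terms in s^4 and t^4. *)
have -> : Y = 2 * X +
  2 * (4 * n - 2 * n ^+ 2 - 2 * w ^+ 2 - (s ^+ 2 + t ^+ 2)) *
  (1 - (2 * n + n ^+ 2 + w ^+ 2 + 2 / 3 * n ^+ 3 + 2 * n * w ^+ 2)
     + w / 3 * (s ^+ 2 - t ^+ 2)).
  by rewrite /X /Y; field.
rewrite EN; lra.
Qed.

(** * The logarithmic Sobolev inequality *)

Lemma entropy_sq4_le_normalized {R : realType} (g : 'Z_4 -> R) :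
  (forall x, 0 <= g x) -> norm2sq g = 1 ->
  entropy_sq4 g <= 2 * (((g 0 - g 2) ^+ 2 + (g 1 - g 3) ^+ 2) / 8 +
                        (g 0 + g 2 - g 1 - g 3) ^+ 2 / 10).
Proof.
move=> g0 g1; rewrite /entropy_sq4 g1 ln1 mulr0 subr0 /mean4 sum_Z4.
have hM : g 0 ^+ 2 + g 1 ^+ 2 + g 2 ^+ 2 + g 3 ^+ 2 = 4.
  move: g1; rewrite /norm2sq /mean4 sum_Z4 !real_normK ?num_real // => g1.
  by lra.
have := jet_inequality _ _ _ _ (g0 0) (g0 1) (g0 2) (g0 3) hM.
have := sqr_ln_sqr_le_jet _ (g0 0); have := sqr_ln_sqr_le_jet _ (g0 1).
have := sqr_ln_sqr_le_jet _ (g0 2); have := sqr_ln_sqr_le_jet _ (g0 3).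
by lra.
Qed.

Theorem theorem3p1 (R : realType) (f : 'Z_4 -> R) (hf : forall x, 0 <= f x) :
  (entropy_sq4 f)%:C <=
  2 * inner4 (fun x => (f x)%:C) (multiplier4 (@phi4 R) (fun x => (f x)%:C)).
Proof.
rewrite energy_Z4.
have -> : (2 : R[i]) = (2 : R)%:C by rewrite rmorph_nat.
rewrite -rmorphM lecR.
have [Mle|M1] := lerP (norm2sq f) 0.
  have Mz : norm2sq f = 0 by apply/le_anti; rewrite Mle norm2sq_ge0.
  have fz x : f x ^+ 2 = 0.
    move/eqP: Mz; rewrite /norm2sq /mean4 mulf_eq0 invr_eq0 pnatr_eq0 /=.
    rewrite psumr_eq0 => [/allP/(_ x)|y _]; last by rewrite exprn_ge0.
    by rewrite mem_index_enum real_normK ?num_real // => /(_ isT)/eqP.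
  have -> : entropy_sq4 f = 0.
    rewrite /entropy_sq4 Mz mul0r subr0 /mean4 big1 ?mulr0 // => x _.
    by rewrite fz mul0r.
  by rewrite mulr_ge0 // addr_ge0 // divr_ge0 // ?addr_ge0 // sqr_ge0.
set r := Num.sqrt (norm2sq f).
have r0 : 0 < r by rewrite sqrtr_gt0.
have r2 : r ^+ 2 = norm2sq f by rewrite sqr_sqrtr ?norm2sq_ge0.
pose g x := f x / r.
have Ef : f = fun x => r * g x.
  by apply/funext => x; rewrite /g mulrC divfK ?gt_eqF.
have g1 : norm2sq g = 1.
  apply: (mulfI (lt0r_neq0 (exprn_gt0 2 r0))).
  by rewrite mulr1 -norm2sq_scale -Ef r2.
have g0 x : 0 <= g x by rewrite /g divr_ge0 // ltW.
have H := entropy_sq4_le_normalized g g0 g1.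
clearbody g r; rewrite Ef entropy_sq4_scale //.
have := ler_wpM2l (ltW (exprn_gt0 2 r0)) H.
by lra.
Qed.
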